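(* Let $X$ be a Hausdorff real locally convex space whose topology is generated by a countable directed family $(p_n)_{n\in\mathbb{N}}$ of seminorms ($n=1,2,\dots$), and let $$d(x,y)=\sum_{n=1}^\infty\frac1{2^n}\cdot\frac{p_n(x-y)}{1+p_n(x-y)},\qquad x,y\in X,$$ be the associated translation invariant metric, which generates the topology of $X$. Let $\Omega$ be an open convex subset of $X$. If $f:\Omega\to\mathbb{R}$ is a continuous convex function, then $f$ is locally Lipschitz on $\Omega$ with respect to $d$, that is, every $x_0\in\Omega$ has a neighborhood $V\subset\Omega$ for which there is $L\ge0$ with $|f(x)-f(y)|\le L\,d(x,y)$ for all $x,y\in V$.
   Context: A family $P$ of seminorms is directed if for all $p,p'\in P$ there is $p''\in P$ with $p''\ge p$ and $p''\ge p'$. *)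

(* Defs.v *)
From HB Require Import structures.
From mathcomp Require Import all_boot all_order all_algebra.
From mathcomp Require Import all_classical all_reals all_analysis.

Set Implicit Arguments.
Unset Strict Implicit.
Unset Printing Implicit Defensive.

Import Order.TTheory GRing.Theory Num.Theory.
Import numFieldNormedType.Exports.

Local Open Scope classical_set_scope.
Local Open Scope ring_scope.

(* Nonnegativity of p and p 0 = 0 follow from the two axioms. *)
Definition seminorm (R : realType) (X : lmodType R) (p : X -> R) : Prop :=
  (forall x y, p (x + y) <= p x + p y) /\
  (forall (a : R) x, p (a *: x) = `|a| * p x).

Definition directed_seminorms (R : realType) (X : lmodType R) (I : Type)
    (p : I -> X -> R) : Prop :=
  forall i j, exists k, forall x, p i x <= p k x /\ p j x <= p k x.

(* The finite intersections of open p i-balls around x form a base of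
   neighborhoods of x; no directedness of the family is presupposed. *)
Definition generated_by_seminorms (R : realType) (X : tvsType R) (I : eqType)
    (p : I -> X -> R) : Prop :=
  forall (x : X) (A : set X),
    nbhs x A <->
    exists (s : seq I) (e : R), 0 < e /\
      [set y | forall i, i \in s -> p i (y - x) < e] `<=` A.

(* The family is indexed from 0: p n is the (n+1)-st seminorm of the sequence,
   whence the weight 1 / 2 ^ (n+1). *)
Definition seminorms_dist (R : realType) (X : lmodType R) (p : nat -> X -> R)
    (x y : X) : R :=
  limn (series (fun n => 1 / 2 ^+ n.+1 * (p n (x - y) / (1 + p n (x - y))))).

Definition locally_lipschitz_on (R : realType) (X : tvsType R)
    (d : X -> X -> R) (Omega : set X) (f : X -> R) : Prop :=
  forall x0, Omega x0 ->
    exists V : set X, [/\ nbhs x0 V, V `<=` Omega &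
      exists L : R, 0 <= L /\
        forall x y, V x -> V y -> `|f x - f y| <= L * d x y].

(* Main.v *)
(* A continuous f is bounded on a small ball of one seminorm q = p k, by
   directedness; a convex function bounded on a q-ball of radius 2r is Lipschitz
   with respect to q on the ball of radius r. There q (x - y) is bounded, so it is
   comparable to q (x - y) / (1 + q (x - y)), and hence dominated by a multiple of
   the k-th term of the series defining the metric. *)
Require Import Defs.
From HB Require Import structures.
From mathcomp Require Import all_boot all_order all_algebra.
From mathcomp Require Import all_classical all_reals all_analysis.
From mathcomp Require Import ring lra.
Import Order.TTheory GRing.Theory Num.Theory.
Import numFieldNormedType.Exports.
Local Open Scope classical_set_scope.
Local Open Scope ring_scope.

Lemma seminorm0 {R : realType} {X : lmodType R} {q : X -> R} :
  seminorm q -> q 0 = 0.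
Proof. by case=> _ qZ; rewrite -(scale0r 0) qZ normr0 mul0r. Qed.

Lemma seminormN {R : realType} {X : lmodType R} {q : X -> R} x :
  seminorm q -> q (- x) = q x.
Proof. by case=> _ qZ; rewrite -scaleN1r qZ normrN1 mul1r. Qed.

Lemma seminorm_ge0 {R : realType} {X : lmodType R} {q : X -> R} x :
  seminorm q -> 0 <= q x.
Proof.
move=> sq; have [qD _] := sq.
have := qD x (- x); rewrite subrr seminorm0// seminormN//; lra.
Qed.

(** The index [i0] is the witness for the empty sequence; each further index is absorbed by
    directedness. *)
Lemma directed_seminorms_seq {R : realType} {X : lmodType R} {I : eqType}
    (i0 : I) {p : I -> X -> R} (s : seq I) :
  directed_seminorms p ->
  exists k, forall i x, i \in s -> p i x <= p k x.
Proof.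
move=> pdir; elim: s => [|j s [k kP]]; first by exists i0.
have [l lP] := pdir j k; exists l => i x.
rewrite in_cons => /predU1P[->|js]; first by have [] := lP x.
by apply: le_trans (kP i x js) _; have [] := lP x.
Qed.

(** All terms are nonnegative and the series converges, so each single term is at most the sum. *)
Lemma seminorms_dist_ge {R : realType} {X : lmodType R} {p : nat -> X -> R}
    (n : nat) (x y : X) :
  (forall n, seminorm (p n)) ->
  1 / 2 ^+ n.+1 * (p n (x - y) / (1 + p n (x - y))) <= seminorms_dist p x y.
Proof.
move=> sp; rewrite /seminorms_dist; set u := (fun n => _).
have p_ge0 i : 0 <= p i (x - y) by exact: seminorm_ge0.
have u_ge0 i : 0 <= u i.
  by rewrite /u mulr_ge0 ?divr_ge0 ?exprn_ge0 ?addr_ge0 ?p_ge0.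
(* Since [a / (1 + a) <= 1] for [a >= 0], the term is at most its weight. *)
have u_le i : u i <= geometric (1 / 2) 2^-1 i.
  rewrite /u /geometric /= exprS invfM exprVn !mul1r -[leRHS]mulr1.
  rewrite ler_wpM2l ?mulr_ge0 ?invr_ge0 ?exprn_ge0// ler_pdivrMr; have := p_ge0 i; lra.
have cu : cvgn (series u).
  apply: (series_le_cvg u_ge0 _ u_le).
    by move=> i; apply: le_trans (u_le i).
  by apply: is_cvg_geometric_series; rewrite ger0_norm; lra.
(* The partial sum up to [n.+1] excludes that bound, so its last term is the one of index [n]. *)
apply: le_trans (nondecreasing_cvgn_le _ cu n.+1).
  by rewrite /series /= big_nat_recr//= lerDr sumr_ge0.
by apply: nondecreasing_series => i _ _.
Qed.

Lemma convex_function_le {R : realType} {X : lmodType R} {D : set X}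
    {f : X -> R} {t : R} {x y : X} :
  convex_function D f -> D x -> D y -> 0 <= t -> t <= 1 ->
  f (t *: x + (1 - t) *: y) <= t * f x + (1 - t) * f y.
Proof.
move=> cf Dx Dy t0 t1.
exact: (cf (Itv01 t0 t1) x y (mem_set Dx) (mem_set Dy)).
Qed.

(** The doubled radius leaves room to prolong the segment from [x] to [y]; convexity compares its
    slope with that of the longer segment, whose endpoint values differ by at most [M + M].
    Exchanging [x] and [y] gives the two-sided estimate. *)
Lemma convex_function_le_seminorm {R : realType} {X : lmodType R}
    {D : set X} {f q : X -> R} {x0 : X} {r M : R} :
  seminorm q -> convex_function D f -> 0 < r ->
  [set y | q (y - x0) < r + r] `<=` D ->
  (forall y, q (y - x0) < r + r -> `|f y| <= M) ->
  forall x y, q (x - x0) < r -> q (y - x0) < r ->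
  f y - f x <= (M + M) / r * q (y - x).
Proof.
move=> sq cf r0 ballD fM x y qx qy; have [qD qZ] := sq.
have q_ge0 := seminorm_ge0 (y - x) sq.
have ball2 z : q (z - x0) < r -> q (z - x0) < r + r by lra.
have M0 : 0 <= M by exact: le_trans (fM _ (ball2 _ qx)).
(* Extend the segment from x through y by less than r beyond y; the slack
   between [del] and [q (y - x)] covers the case [q (y - x) = 0]. *)
have step del : q (y - x) < del -> f y - f x <= (M + M) / r * del.
  move=> qdel; have del0 : 0 < del by exact: le_lt_trans qdel.
  pose z := y + (r / del) *: (y - x).
  have qz : q (z - x0) < r + r.
    rewrite /z addrAC; apply: le_lt_trans (qD _ _) _.
    apply: ltrD => //; rewrite qZ ger0_norm ?divr_ge0 ?ltW//.
    by rewrite mulrAC ltr_pdivrMr// ltr_pM2l.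
  have rd0 : 0 < r + del by exact: addr_gt0.
  (* As [z - x] is [(r + del) / del] times [y - x], this is the weight that places [y] between [x]
     and [z]. *)
  pose t := del / (r + del).
  have t0 : 0 <= t by rewrite divr_ge0 ?ltW.
  have t1 : t <= 1 by rewrite ler_pdivrMr//; lra.
  have yE : y = t *: z + (1 - t) *: x.
    have trd : t * (r / del) = 1 - t.
      by rewrite /t; field; rewrite !gt_eqF.
    rewrite /z scalerDr scalerA trd -addrA -scalerDr subrK.
    by rewrite scalerBl scale1r addrC subrK.
  have := convex_function_le cf (ballD _ qz) (ballD _ (ball2 _ qx)) t0 t1.
  rewrite -yE => fy.
  have := fM _ qz; have := fM _ (ball2 _ qx).
  rewrite !ler_norml => /andP[fx1 fx2] /andP[fz1 fz2].
  have h1 : f y - f x <= t * (M + M).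
    have : t * (f z - f x) <= t * (M + M) by apply: ler_wpM2l => //; lra.
    by lra.
  (* It remains to use [t <= del / r]. *)
  apply: (le_trans h1); rewrite mulrC -mulrA ler_wpM2l ?addr_ge0//.
  by rewrite /t mulrC ler_pM2r// lef_pV2 ?posrE// lerDl ltW.
(* Let [del] decrease to [q (y - x)]. The excess [e / (K + 1)] costs at most [e], and its
   denominator is positive even when [K = 0]. *)
apply/ler_addgt0Pr => e e0.
pose K := (M + M) / r.
have K0 : 0 <= K by rewrite divr_ge0 ?addr_ge0// ltW.
have := step (q (y - x) + e / (K + 1)); rewrite -/K ltrDl divr_gt0// ?ltr_wpDl//.
move=> /(_ isT) /le_trans; apply; rewrite mulrDr lerD2l.
by rewrite mulrCA ger_pMr// ler_pdivrMr; lra.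
Qed.

Theorem proposition8p2 (R : realType) (X : tvsType R)
    (hX : hausdorff_space X)
    (p : nat -> X -> R)
    (hp : forall n, seminorm (p n))
    (hdir : directed_seminorms p)
    (hgen : generated_by_seminorms p)
    (Omega : set X)
    (hopen : open Omega)
    (hconv : convex_set Omega)
    (f : X -> R)
    (hcont : {within Omega, continuous f})
    (hf : convex_function Omega f) :
  locally_lipschitz_on (seminorms_dist p) Omega f.
Proof.
move=> x0 Ox0.
have cf : {for x0, continuous f}.
  by move: hcont; rewrite continuous_open_subspace//; apply; exact: mem_set.
have : nbhs x0 (Omega `&` [set y | `|f x0 - f y| < 1]).
  apply: filterI; first exact: open_nbhs_nbhs.
  by move/cvgrPdist_lt: cf => /(_ 1 ltr01).
move=> /hgen[s [e [e0 sP]]].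
have [k kP] := directed_seminorms_seq 0%N s hdir.
(* Halving makes the ball of radius [r + r] the one on which [f] stays within 1 of [f x0]. *)
pose r := e / 2; have r0 : 0 < r by rewrite divr_gt0.
have rr : r + r = e by rewrite /r; lra.
have ballP y : p k (y - x0) < r + r -> Omega y /\ `|f x0 - f y| < 1.
  by rewrite rr => ye; apply: sP => i si; apply: le_lt_trans (kP i _ si) ye.
have sub2 y : p k (y - x0) < r -> p k (y - x0) < r + r by lra.
pose M := `|f x0| + 1.
have fM y : p k (y - x0) < r + r -> `|f y| <= M.
  move=> /ballP[_ fy]; rewrite /M -(subKr (f x0) (f y)).
  by apply: le_trans (ler_normB _ _) _; rewrite lerD2l ltW.
have lip := convex_function_le_seminorm (hp k) hf r0 (fun y h => (ballP y h).1) fM.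
pose K := (M + M) / r.
have K0 : 0 <= K by rewrite divr_ge0 ?(ltW r0)// !addr_ge0.
exists [set y | p k (y - x0) < r]; split.
- apply/hgen; exists [:: k], r; split=> // y /(_ k); apply.
  by rewrite mem_head.
- by move=> y /sub2/ballP[].
(* The factor [2 ^+ k.+1] cancels the weight of the [k]-th term, and [1 + e] bounds
   [1 + p k (x - y)] on the ball, whose diameter is at most [r + r = e]. *)
have c0 : 0 < (1 + e) * 2 ^+ k.+1 :> R by rewrite mulr_gt0 ?exprn_gt0 ?addr_gt0.
exists (K * ((1 + e) * 2 ^+ k.+1)); split; first by rewrite mulr_ge0// ltW.
move=> x y Vx Vy.
have [pD _] := hp k.
have pC : p k (y - x) = p k (x - y) by rewrite -(seminormN _ (hp k)) opprB.
have lip2 : `|f x - f y| <= K * p k (x - y).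
  by rewrite ler_norml lerNl opprB -{1}pC !lip.
apply: (le_trans lip2); rewrite -[leRHS]mulrA ler_wpM2l//.
have := seminorms_dist_ge k x y hp.
have a0 := seminorm_ge0 (x - y) (hp k).
have ae : p k (x - y) <= e.
  have -> : x - y = (x - x0) - (y - x0) by rewrite opprB addrA subrK.
  rewrite -rr; apply: le_trans (pD _ _) _; rewrite (seminormN _ (hp k)).
  by apply: lerD; exact: ltW.
move=> /(ler_wpM2l (ltW c0)); apply: le_trans.
set a := p k _ in a0 ae *.
have -> : (1 + e) * 2 ^+ k.+1 * (1 / 2 ^+ k.+1 * (a / (1 + a)))
          = (1 + e) / (1 + a) * a.
  field; rewrite expf_neq0 ?pnatr_eq0 ?andbT//; lra.
(* From [a <= e] the factor [(1 + e) / (1 + a)] is at least 1. *)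
rewrite ler_peMl// ler_pdivlMr; lra.
Qed.
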